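(* For $s\in[-1,1]$ let $\gamma_{1,3}^s(t)=(1-s)\exp(2\pi i t)+(1+s)\exp(6\pi i t)$. For $s\in[-1,1]$ and $t\in[0,1]$, the curve $\gamma_{1,3}^s$ has a cusp point at the parameter $t$ if and only if $s=-1/2$ and ($t=1/4$ or $t=3/4$).
   Context: The curve is regarded as a smooth one-periodic parametrised curve in $\mathbb{C}\cong\mathbb{R}^2$, defined by the same formula for all $t\in\mathbb{R}$. A parameter $t$ is a singular point of a curve $\gamma$ if $\gamma'(t)=0$. A curve $\gamma$ has a cusp point at $t_0$ if $t_0$ is a singular point, and the one-sided limits of the unit tangent vector, $\lim_{t\to t_0^+}\gamma'(t)/\|\gamma'(t)\|$ and $\lim_{t\to t_0^-}\gamma'(t)/\|\gamma'(t)\|$, exist and are opposite (one is the negative of the other). *)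

(* Defs.v *)
From Stdlib Require Import Reals Lra Lia.
From Coquelicot Require Import Coquelicot.
Open Scope R_scope.

(* Coquelicot has no complex exponential: e^(x+iy) = e^x (cos y + i sin y). *)
Definition Cexp (z : C) : C := (exp (Re z) * cos (Im z), exp (Re z) * sin (Im z)).

Definition smooth (f : R -> C) : Prop :=
  forall (n : nat) (t : R),
    ex_derive_n (fun u => Re (f u)) n t /\ ex_derive_n (fun u => Im (f u)) n t.

Record curve : Type := Curve {
  point :> R -> C;
  curve_smooth : smooth point;
  curve_periodic : forall t, point (t + 1) = point t
}.

Definition velocity (g : curve) (t : R) : C :=
  (Derive (fun u => Re (g u)) t, Derive (fun u => Im (g u)) t).

Definition singular_point (g : curve) (t : R) : Prop := velocity g t = RtoC 0.

(* Meaningful only where [velocity g t <> 0]. *)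
Definition unit_tangent (g : curve) (t : R) : C :=
  (velocity g t / Cmod (velocity g t))%C.

(* Division is total, so the first conjunct is what makes the unit tangent
   genuinely defined along [F]; without it a constant curve would have limit 0. *)
Definition unit_tangent_limit (g : curve) (F : (R -> Prop) -> Prop) (u : C) : Prop :=
  F (fun t => ~ singular_point g t) /\ filterlim (unit_tangent g) F (locally u).

Definition cusp_point (g : curve) (t0 : R) : Prop :=
  singular_point g t0 /\
  exists u v : C,
    unit_tangent_limit g (at_right t0) u /\
    unit_tangent_limit g (at_left t0) v /\
    u = (- v)%C.

Definition gamma13_fun (s t : R) : C :=
  ((1 - s) * Cexp (2 * PI * Ci * t) + (1 + s) * Cexp (6 * PI * Ci * t))%C.

Lemma gamma13_funE (s t : R) :
  gamma13_fun s t =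
  ((1 - s) * cos (2 * PI * t) + (1 + s) * cos (6 * PI * t),
   (1 - s) * sin (2 * PI * t) + (1 + s) * sin (6 * PI * t)).
Proof.
assert (H : forall a : R,
  Cexp (RtoC a * RtoC PI * Ci * RtoC t)%C = (cos (a * PI * t), sin (a * PI * t))).
{ intros a; unfold Cexp, Re, Im; simpl.
  match goal with |- (exp ?x * cos ?y, _) = _ =>
    replace x with 0 by ring; replace y with (a * PI * t) by ring end.
  now rewrite exp_0, !Rmult_1_l. }
unfold gamma13_fun; rewrite !H.
unfold Cplus, Cmult, Cminus, Copp, Cplus, RtoC; simpl; f_equal; ring.
Qed.

Lemma ex_derive_n_cos_sin (n : nat) (t : R) :
  ex_derive_n cos n t /\ ex_derive_n sin n t.
Proof.
assert (H : forall m, exists a b : R,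
  (forall x, Derive_n cos m x = a * cos x + b * sin x) /\
  (forall x, Derive_n sin m x = - b * cos x + a * sin x)).
{ induction m as [|m (a & b & Hc & Hs)].
  - exists 1, 0; split; intros x; simpl; ring.
  - exists b, (- a); split; intros x; simpl.
    + rewrite (Derive_ext _ _ _ Hc); apply is_derive_unique.
      auto_derive; [easy | ring].
    + rewrite (Derive_ext _ _ _ Hs); apply is_derive_unique.
      auto_derive; [easy | ring]. }
destruct n as [|n]; [easy|].
destruct (H n) as (a & b & Hc & Hs); split; simpl.
- apply (ex_derive_ext (fun x => a * cos x + b * sin x)); [now intros; rewrite Hc|].
  now auto_derive.
- apply (ex_derive_ext (fun x => - b * cos x + a * sin x)); [now intros; rewrite Hs|].
  now auto_derive.
Qed.

Lemma ex_derive_n_lin_comb (f : R -> R) (p q a b : R) (n : nat) (t : R) :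
  (forall m x, ex_derive_n f m x) ->
  ex_derive_n (fun u => p * f (a * u) + q * f (b * u)) n t.
Proof.
intros Hf.
assert (H : forall c k m x, ex_derive_n (fun u => c * f (k * u)) m x).
{ intros c k m x; apply ex_derive_n_scal_l, ex_derive_n_comp_scal.
  apply filter_forall; intros; apply Hf. }
apply ex_derive_n_plus; apply filter_forall; intros; apply H.
Qed.

Lemma gamma13_smooth (s : R) : smooth (gamma13_fun s).
Proof.
intros n t; split.
- apply (ex_derive_n_ext
    (fun u => (1 - s) * cos (2 * PI * u) + (1 + s) * cos (6 * PI * u))).
  + now intros u; rewrite gamma13_funE.
  + apply ex_derive_n_lin_comb; intros; apply ex_derive_n_cos_sin.
- apply (ex_derive_n_ext
    (fun u => (1 - s) * sin (2 * PI * u) + (1 + s) * sin (6 * PI * u))).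
  + now intros u; rewrite gamma13_funE.
  + apply ex_derive_n_lin_comb; intros; apply ex_derive_n_cos_sin.
Qed.

Lemma gamma13_periodic (s t : R) : gamma13_fun s (t + 1) = gamma13_fun s t.
Proof.
rewrite !gamma13_funE.
replace (2 * PI * (t + 1)) with (2 * PI * t + 2 * INR 1 * PI) by (simpl; ring).
replace (6 * PI * (t + 1)) with (6 * PI * t + 2 * INR 3 * PI) by (simpl; ring).
now rewrite !cos_period, !sin_period.
Qed.

Definition gamma13 (s : R) : curve :=
  Curve (gamma13_fun s) (gamma13_smooth s) (gamma13_periodic s).

(* Main.v *)
(** With [theta = 2 PI t], the velocity is
    [2 PI i e^(i theta) ((1 - s) + 3 (1 + s) e^(2 i theta))].  It vanishes only if the
    moduli [1 - s] and [3 (1 + s)] agree, i.e. [s = -1/2], and [e^(2 i theta) = -1].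
    For [s = -1/2] it equals the real factor [6 PI cos theta], which has simple zeros,
    times the unit vector [i e^(2 i theta)]; so the unit tangent flips at each zero. *)
Require Import Defs.
From Stdlib Require Import Reals Lra.
From Coquelicot Require Import Coquelicot.
Open Scope R_scope.

(** Taking the slope [l] itself as the tolerance keeps the difference quotient strictly between [0]
    and [2 * l] near [x]. Since [k x = 0], [k y] then has the sign of [y - x]. *)
Lemma is_derive_pos_sign (k : R -> R) (x l : R) :
  is_derive k x l -> k x = 0 -> 0 < l ->
  at_right x (fun y => 0 < k y) /\ at_left x (fun y => k y < 0).
Proof.
intros Hk Hx Hl.
apply is_derive_Reals in Hk.
destruct (Hk l Hl) as [d Hd].
assert (H : forall y : R, ball x d y -> y <> x -> 0 < k y / (y - x)).
{ intros y Hy Hne.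
  assert (Hy' : Rabs (y - x) < d) by exact Hy.
  specialize (Hd (y - x) ltac:(lra) Hy').
  replace (x + (y - x)) with y in Hd by lra.
  rewrite Hx, Rminus_0_r in Hd.
  apply Rabs_def2 in Hd; lra. }
split; exists d; intros y Hy Hlt; specialize (H y Hy ltac:(lra)).
- replace (k y) with (k y / (y - x) * (y - x)) by (field; lra).
  apply Rmult_lt_0_compat; lra.
- replace (k y) with (- (k y / (y - x) * (x - y))) by (field; lra).
  apply Ropp_lt_gt_0_contravar, Rmult_lt_0_compat; lra.
Qed.

Lemma unit_tangent_scal (g : curve) (t k : R) (w : C) :
  velocity g t = (k * w)%C -> Cmod w = 1 -> 0 < k -> unit_tangent g t = w.
Proof.
intros Hv Hw Hk; unfold unit_tangent.
rewrite Hv, Cmod_mult, Hw, Cmod_R, Rabs_pos_eq, Rmult_1_r by lra.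
field; intros H; apply RtoC_inj in H; lra.
Qed.

Lemma nonsingular_scal (g : curve) (t k : R) (w : C) :
  velocity g t = (k * w)%C -> Cmod w = 1 -> k <> 0 -> ~ singular_point g t.
Proof.
unfold singular_point; intros Hv Hw Hk Hs.
rewrite Hv in Hs; apply (f_equal Cmod) in Hs.
rewrite Cmod_mult, Hw, Cmod_R, Cmod_0, Rmult_1_r in Hs.
now apply Rabs_no_R0 in Hk.
Qed.

(** The factor [k] passes from negative to positive at [t0], so the unit tangent is [- w] just
    before and [w] just after. Continuity of [w] turns this into the opposite limits [- w t0] and
    [w t0]. *)
Lemma cusp_of_simple_zero_pos (g : curve) (k : R -> R) (w : R -> C) (t0 l : R) :
  (forall t, velocity g t = (k t * w t)%C) -> (forall t, Cmod (w t) = 1) ->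
  continuous w t0 -> k t0 = 0 -> is_derive k t0 l -> 0 < l -> cusp_point g t0.
Proof.
intros Hv Hw Hc H0 Hk Hl.
destruct (is_derive_pos_sign k t0 l Hk H0 Hl) as [Hr Hf].
split.
{ unfold singular_point; rewrite Hv, H0; ring. }
exists (w t0), (- w t0)%C; split; [|split; [|ring]]; split.
- revert Hr; apply filter_imp; intros t Ht.
  apply (nonsingular_scal g t (k t) (w t)); auto; lra.
- apply (filterlim_ext_loc w).
  + revert Hr; apply filter_imp; intros t Ht; symmetry.
    now apply (unit_tangent_scal g t (k t)).
  + apply filterlim_filter_le_1 with (2 := Hc), filter_le_within.
- revert Hf; apply filter_imp; intros t Ht.
  apply (nonsingular_scal g t (k t) (w t)); auto; lra.
- apply (filterlim_ext_loc (fun t => (- w t)%C)).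
  + revert Hf; apply filter_imp; intros t Ht; symmetry.
    (* Here [k t < 0], so the velocity is read as [(- k t) * (- w t)], with a positive factor. *)
    apply (unit_tangent_scal g t (- k t)); [|now rewrite Cmod_opp|lra].
    rewrite Hv, RtoC_opp; ring.
  + apply filterlim_filter_le_1 with
      (2 := continuous_opp (V := C_R_NormedModule) w t0 Hc), filter_le_within.
Qed.

Lemma cusp_of_simple_zero (g : curve) (k : R -> R) (w : R -> C) (t0 l : R) :
  (forall t, velocity g t = (k t * w t)%C) -> (forall t, Cmod (w t) = 1) ->
  continuous w t0 -> k t0 = 0 -> is_derive k t0 l -> l <> 0 -> cusp_point g t0.
Proof.
intros Hv Hw Hc H0 Hk Hl.
destruct (Rdichotomy _ _ Hl) as [Hn|Hp].
(* A negative slope becomes positive when both factors of the velocity change sign. *)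
- apply (cusp_of_simple_zero_pos g (fun t => - k t) (fun t => - w t)%C t0 (- l)).
  + intros t; rewrite Hv, RtoC_opp; ring.
  + intros t; now rewrite Cmod_opp.
  + exact (continuous_opp (V := C_R_NormedModule) w t0 Hc).
  + lra.
  + exact (is_derive_opp k t0 l Hk).
  + lra.
- now apply (cusp_of_simple_zero_pos g k w t0 l).
Qed.

(** Balls of the product uniform structure on [C] are products of balls, so each coordinate is
    handled separately. *)
Lemma continuous_Cpair (f h : R -> R) (t : R) :
  continuous f t -> continuous h t -> continuous (fun u => (f u, h u) : C) t.
Proof.
intros Hf Hh; apply filterlim_locally; intros eps.
apply filter_and; [now apply (proj1 (filterlim_locally f _) Hf) |
                   now apply (proj1 (filterlim_locally h _) Hh)].
Qed.

Lemma Cmod_sin_cos (x : R) : Cmod (- sin x, cos x) = 1.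
Proof.
unfold Cmod; simpl; transitivity (sqrt 1); [f_equal | apply sqrt_1].
generalize (sin2_cos2 x); unfold Rsqr; lra.
Qed.

Lemma velocity_gamma13 (s t : R) :
  velocity (gamma13 s) t =
  (- (2 * PI) * ((1 - s) * sin (2 * PI * t) + 3 * (1 + s) * sin (6 * PI * t)),
   2 * PI * ((1 - s) * cos (2 * PI * t) + 3 * (1 + s) * cos (6 * PI * t))).
Proof.
unfold velocity; f_equal.
- rewrite (Derive_ext _ (fun u => (1 - s) * cos (2 * PI * u) + (1 + s) * cos (6 * PI * u)))
    by (intros u; exact (f_equal Re (gamma13_funE s u))).
  apply is_derive_unique; auto_derive; [easy | ring].
- rewrite (Derive_ext _ (fun u => (1 - s) * sin (2 * PI * u) + (1 + s) * sin (6 * PI * u)))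
    by (intros u; exact (f_equal Im (gamma13_funE s u))).
  apply is_derive_unique; auto_derive; [easy | ring].
Qed.

(** At [s = -1 / 2] the coefficients [1 - s] and [3 * (1 + s)] both equal [3 / 2], and the angles
    [2 * PI * t] and [6 * PI * t] lie symmetrically about [4 * PI * t]. The sum-to-product formulas
    therefore apply. *)
Lemma velocity_gamma13_half (t : R) :
  velocity (gamma13 (-1 / 2)) t =
  Cmult (RtoC (6 * PI * cos (2 * PI * t))%R) (- sin (4 * PI * t), cos (4 * PI * t)).
Proof.
rewrite velocity_gamma13; unfold Cmult, RtoC; simpl.
replace (6 * PI * t) with (4 * PI * t + 2 * PI * t) by ring.
replace (sin (2 * PI * t)) with (sin (4 * PI * t - 2 * PI * t)) by (f_equal; ring).
(* Only the occurrence in the velocity is expanded; the scalar factor on the right keeps its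
   cosine. *)
replace (cos (2 * PI * t)) with (cos (4 * PI * t - 2 * PI * t)) at 1 by (f_equal; ring).
rewrite sin_minus, sin_plus, cos_minus, cos_plus; f_equal; field.
Qed.

Lemma cusp_gamma13_half (t : R) :
  cos (2 * PI * t) = 0 -> cusp_point (gamma13 (-1 / 2)) t.
Proof.
intros Hcos.
apply (cusp_of_simple_zero _ (fun u => 6 * PI * cos (2 * PI * u))
  (fun u => (- sin (4 * PI * u), cos (4 * PI * u)) : C) t
  (- (12 * PI * PI) * sin (2 * PI * t))).
- exact velocity_gamma13_half.
- intros u; apply Cmod_sin_cos.
- apply continuous_Cpair; apply (ex_derive_continuous (V := R_NormedModule));
    now auto_derive.
- rewrite Hcos; ring.
- auto_derive; [easy | ring].
(* The zero is simple because sine and cosine have no common zero. *)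
- pose proof PI_RGT_0.
  apply Rmult_integral_contrapositive_currified; [nra|].
  intros Hsin; generalize (sin2_cos2 (2 * PI * t)).
  rewrite Hsin, Hcos; unfold Rsqr; lra.
Qed.

Lemma singular_gamma13 (s t : R) :
  -1 <= s <= 1 -> singular_point (gamma13 s) t ->
  s = -1 / 2 /\ cos (2 * PI * t) = 0.
Proof.
unfold singular_point; rewrite velocity_gamma13; intros Hs H.
injection H as H1 H2.
pose proof PI_RGT_0 as Hpi.
apply Rmult_integral in H1; destruct H1 as [H1|H1]; [lra|].
apply Rmult_integral in H2; destruct H2 as [H2|H2]; [lra|].
assert (E1 := sin2_cos2 (2 * PI * t)).
assert (E3 := sin2_cos2 (6 * PI * t)).
unfold Rsqr in E1, E3.
(* Squaring and adding the two coordinate equations eliminates [t] and compares the squared moduli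
   of the two terms. *)
assert (Es : (1 - s) * (1 - s) = 3 * (1 + s) * (3 * (1 + s))).
{ set (x := sin (2 * PI * t)) in *; set (y := cos (2 * PI * t)) in *.
  set (p := sin (6 * PI * t)) in *; set (q := cos (6 * PI * t)) in *.
  replace ((1 - s) * (1 - s)) with
    (((1 - s) * x) * ((1 - s) * x) + ((1 - s) * y) * ((1 - s) * y))
    by (transitivity ((1 - s) * (1 - s) * (x * x + y * y)); [ring | rewrite E1; ring]).
  replace ((1 - s) * x) with (- (3 * (1 + s) * p)) by lra.
  replace ((1 - s) * y) with (- (3 * (1 + s) * q)) by lra.
  transitivity (3 * (1 + s) * (3 * (1 + s)) * (p * p + q * q)); [ring | rewrite E3; ring]. }
(* The other root of [Es] is [-2], outside the range of [s]. *)
assert (Hhalf : s = -1 / 2) by nra.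
split; [exact Hhalf|].
assert (Hv : velocity (gamma13 (-1 / 2)) t = RtoC 0).
{ rewrite velocity_gamma13, <- Hhalf, H1, H2; unfold RtoC; f_equal; ring. }
(* With a nonzero cosine, the factored velocity would be a nonzero multiple of a unit vector. *)
destruct (Req_dec (cos (2 * PI * t)) 0) as [|Hne]; [easy|exfalso].
revert Hv; apply (nonsingular_scal _ _ _ _ (velocity_gamma13_half t)).
- apply Cmod_sin_cos.
- apply Rmult_integral_contrapositive_currified; lra.
Qed.

Lemma cos_2PI_eq_0 (t : R) :
  0 <= t <= 1 -> cos (2 * PI * t) = 0 <-> t = 1 / 4 \/ t = 3 / 4.
Proof.
intros Ht; pose proof PI_RGT_0 as Hpi; split.
- intros H; apply cos_eq_0_2PI_0 in H; [|nra|nra].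
  destruct H as [H|H]; [left|right]; apply (Rmult_eq_reg_l (2 * PI)); lra.
- intros [-> | ->].
  + replace (2 * PI * (1 / 4)) with (PI / 2) by field; apply cos_PI2.
  + replace (2 * PI * (3 / 4)) with (3 * (PI / 2)) by field; apply cos_3PI2.
Qed.

Theorem theorem2 (s t : R) (hs : -1 <= s <= 1) (ht : 0 <= t <= 1) :
  cusp_point (gamma13 s) t <-> s = -1 / 2 /\ (t = 1 / 4 \/ t = 3 / 4).
Proof.
rewrite <- (cos_2PI_eq_0 t ht); split.
- intros [Hsing _]; exact (singular_gamma13 s t hs Hsing).
- intros [-> Hcos]; exact (cusp_gamma13_half t Hcos).
Qed.
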